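(* Let $r\ge 1$ be a fixed integer. Assume that the sequence of irregular grids $c=z_0<z_1<\cdots<z_n=d$ satisfies the refinement condition: there exists a constant $C>0$, independent of $n$, such that $$h_n:=\max_{0\le k\le n-1}(z_{k+1}-z_k)\le\frac{C}{n}.$$ Such a condition is fulfilled, for instance, by any quasi-uniform family of grids of $[c,d]$. Let $g\in C^{r+1}[c,d]$. Then the Taylor-accelerated neural network interpolation operator $\widetilde{T}_{n,r}$ satisfies $$\|\widetilde{T}_{n,r}(g)-g\|_\infty\le\widetilde{C}_r\,n^{-(r+1)}\,\|g^{(r+1)}\|_\infty,$$ where $\widetilde{C}_r>0$ is independent of $n$ and depends only on $r$ and the operator parameters.
   Context: Setting. $[c,d]\subset\mathbb{R}$ is a compact interval, functions are real-valued, $\|g\|_\infty=\max_{y\in[c,d]}|g(y)|$, and $C^{s}[c,d]$ is the space of functions whose derivatives up to order $s$ exist and are continuous on $[c,d]$. Irregular grids. A grid is a partition $c=z_0<z_1<\cdots<z_n=d$ (its nodes may depend on $n$), not necessarily uniform, whose mesh sizes satisfy $0<d_1\le z_{k+1}-z_k\le d_2$ for $k=0,\dots,n-1$, together with the quasi-uniformity condition $d_2<2d_1$. Here $d_1$ denotes the minimum mesh size of the grid; $d_1,d_2$ may depend on the grid, hence on $n$. Activation. For $m>0$, $D(m)$ is the class of sigmoidal functions $\eta:\mathbb{R}\to\mathbb{R}$ (measurable, with limit $0$ at $-\infty$ and $1$ at $+\infty$) that are increasing (in the non-strict sense), with $\eta(y)=0$ for $y\le -m$, $\eta(y)=1$ for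 $y\ge m$, and $0<\eta(y)<1$ for $-m<y<m$. Fix $\eta\in D(m)$ and put $\sigma(y):=\eta(y+m)-\eta(y-m)$, $y\in\mathbb{R}$. Operator. For $g\in C^r[c,d]$ let $P_r(g;y,z_k):=\sum_{j=0}^{r}\frac{g^{(j)}(z_k)}{j!}(y-z_k)^j$ and define the Taylor-accelerated neural network interpolation operator by $$\widetilde{T}_{n,r}(g,y):=\frac{\sum_{k=0}^{n}\sigma\!\left(\frac{2m}{d_1}(y-z_k)\right)P_r(g;y,z_k)}{\sum_{k=0}^{n}\sigma\!\left(\frac{2m}{d_1}(y-z_k)\right)},\qquad y\in[c,d].$$ $\widetilde{T}_{n,r}(g)$ denotes the function $y\mapsto\widetilde{T}_{n,r}(g,y)$. *)

(* Defs.v *)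
From HB Require Import structures.
From mathcomp Require Import all_boot all_order all_algebra.
From mathcomp Require Import all_classical all_reals all_analysis.
Import Order.TTheory GRing.Theory Num.Theory.
Import numFieldNormedType.Exports.

Set Implicit Arguments.
Unset Strict Implicit.
Unset Printing Implicit Defensive.

Local Open Scope classical_set_scope.
Local Open Scope ring_scope.

Section CompactInterval.
Variables (R : realType) (c d : R).

(* The variable y stays in [c, d], so this is the one-sided derivative at the
   two endpoints and the ordinary derivative inside. *)
Definition difference_quotient (f : R -> R) (x y : R) : R :=
  (f y - f x) / (y - x).

Definition derivable_on (f : R -> R) (x : R) : Prop :=
  cvg (difference_quotient f x y @[y --> within `[c, d] x^']).

Definition derive_on (f : R -> R) (x : R) : R :=
  lim (difference_quotient f x y @[y --> within `[c, d] x^']).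

Definition derive_onn (j : nat) (f : R -> R) : R -> R := iter j derive_on f.

(* Only the values of g on [c, d] matter. *)
Definition continuously_derivable (s : nat) (g : R -> R) : Prop :=
  (forall j, (j < s)%N -> {in `[c, d], forall x, derivable_on (derive_onn j g) x})
  /\ (forall j, (j <= s)%N -> {within `[c, d], continuous (derive_onn j g)}).

(* Extended-real valued, so that an unbounded function has norm +oo.  A supremum
   is taken because activations, hence the operators, may be discontinuous; it
   is the maximum whenever the latter exists. *)
Definition sup_norm (f : R -> R) : \bar R :=
  ereal_sup [set `|f y|%:E | y in `[c, d]].

End CompactInterval.

Section Grids.
Variable R : realType.

(* A grid z_0 < ... < z_n is a function on nat of which only the values at
   0, ..., n are used. *)
Definition mesh_max (n : nat) (z : nat -> R) : R :=
  \big[Num.max/0]_(k < n) (z k.+1 - z k).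

(* For n > 0 the default value is the mesh size of index 0. *)
Definition mesh_min (n : nat) (z : nat -> R) : R :=
  \big[Num.min/z 1%N - z 0%N]_(k < n) (z k.+1 - z k).

Record irregular_grid (c d : R) (n : nat) (z : nat -> R) (d1 d2 : R) : Prop := {
  grid_first : z 0%N = c;
  grid_last : z n = d;
  grid_pos : 0 < d1;
  grid_mesh : forall k, (k < n)%N -> d1 <= z k.+1 - z k <= d2;
  grid_min : d1 = mesh_min n z;
  grid_quasi_uniform : d2 < 2 * d1 }.

(* The n-th grid of the family has n + 1 nodes. *)
Definition irregular_grids (c d : R) (z : nat -> nat -> R) (d1 d2 : nat -> R) :=
  forall n, (0 < n)%N -> irregular_grid c d n (z n) (d1 n) (d2 n).

Definition refinement_condition (C : R) (z : nat -> nat -> R) : Prop :=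
  forall n, (0 < n)%N -> mesh_max n (z n) <= C / n%:R.

End Grids.

Section Operator.
Variable R : realType.

Record sigmoidal (eta : R -> R) : Prop := {
  sigmoidal_measurable : measurable_fun [set: R] eta;
  sigmoidal_ninfty : eta y @[y --> -oo] --> (0 : R);
  sigmoidal_pinfty : eta y @[y --> +oo] --> (1 : R) }.

Record activation_class (m : R) (eta : R -> R) : Prop := {
  activation_sigmoidal : sigmoidal eta;
  activation_homo : {homo eta : x y / x <= y};
  activation_left : forall y, y <= - m -> eta y = 0;
  activation_right : forall y, m <= y -> eta y = 1;
  activation_middle : forall y, - m < y < m -> 0 < eta y < 1 }.

Definition sigma (m : R) (eta : R -> R) (y : R) : R :=
  eta (y + m) - eta (y - m).

Definition taylor_poly (c d : R) (r : nat) (g : R -> R) (y x : R) : R :=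
  \sum_(j < r.+1) derive_onn c d j g x / j`!%:R * (y - x) ^+ j.

Definition taylor_nn_operator (c d m : R) (eta : R -> R) (n : nat)
    (z : nat -> R) (d1 : R) (r : nat) (g : R -> R) (y : R) : R :=
  (\sum_(k < n.+1)
      sigma m eta (2 * m / d1 * (y - z k)) * taylor_poly c d r g y (z k))
  / (\sum_(k < n.+1) sigma m eta (2 * m / d1 * (y - z k))).

End Operator.

(* Main.v *)
(** Since sigma is nonnegative and vanishes outside ]-2m, 2m[, the operator is a
    weighted mean of the Taylor values P_r(g; y, z_k) over the nodes z_k with
    |y - z_k| < d1; the denominator is positive because d2 < 2 d1 puts every y
    at distance less than d1 from some node.  The mean value theorem applied to
    t |-> P_r(g; y, t), whose derivative is g^(r+1)(t) / r! (y - t)^r, bounds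
    each error by ||g^(r+1)|| d1^(r+1), and d1 is at most the maximal mesh
    size, hence at most C / n. *)
Require Import Defs.
From HB Require Import structures.
From mathcomp Require Import all_boot all_order all_algebra.
From mathcomp Require Import all_classical all_reals all_analysis.
From mathcomp Require Import ring lra.
Import Order.TTheory GRing.Theory Num.Theory.
Import numFieldNormedType.Exports.
Local Open Scope classical_set_scope.
Local Open Scope ring_scope.

Set Implicit Arguments.
Unset Strict Implicit.
Unset Printing Implicit Defensive.

Lemma within_dnbhs (T : topologicalType) (A : set T) (x : T) :
  nbhs x A -> within A x^' = x^'.
Proof.
move=> Ax; rewrite predeqE => U; split=> [WU|]; last by apply: filterS => y.
have Ax' : x^' A by apply: (filterS _ Ax) => y.
by move: WU; rewrite /within /=; apply: filterS2 Ax' => y Ay /(_ Ay).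
Qed.

(** An interior point has [[c, d]] as a neighbourhood, so restricting the punctured filter changes
    nothing there. The substitution [y = h + x] then turns the quotient into the one that defines
    the usual derivative. *)
Lemma derive_on_is_derive (R : realType) (c d : R) (f : R -> R) (x : R) :
  x \in `]c, d[ -> derivable_on c d f x ->
  is_derive x 1 f (derive_on c d f x).
Proof.
move=> xcd; rewrite /derivable_on /derive_on within_dnbhs; last first.
  apply: filterS (near_in_itvoo xcd) => y; exact: subset_itv_oo_cc.
move=> df.
have shift0 : h + x @[h --> (0 : R)^'] --> x^'.
  rewrite -[X in _ --> X^']add0r.
  apply: (@continuous_injective_withinNx _ _ (fun h => h + x)).
    by apply: continuousD => //; exact: cst_continuous.
  by move=> y /addIr.
have := cvg_comp _ _ shift0 df.
rewrite (_ : _ \o _ = fun h => h^-1 *: ((f \o shift x) (h *: 1) - f x)).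
  move=> dq; apply: DeriveDef; first by apply/cvg_ex; eexists; exact: dq.
  exact: cvg_lim dq.
apply/funext => h.
by rewrite /= /difference_quotient addrK /GRing.scale /= mulr1 mulrC.
Qed.

(** * Taylor sums as functions of the expansion point *)

Section TaylorSum.
Variables (R : realType) (G : nat -> R -> R) (y : R).

Let F r t : R := \sum_(j < r.+1) G j t / j`!%:R * (y - t) ^+ j.

Lemma is_derive_taylor_sum r (t : R) :
  (forall j, (j <= r)%N -> is_derive t 1 (G j) (G j.+1 t)) ->
  is_derive t 1 (F r) (G r.+1 t / r`!%:R * (y - t) ^+ r).
Proof.
elim: r => [|r IHr] dG.
  rewrite (_ : F 0 = G 0) ?fact0 ?divr1 ?expr0 ?mulr1; first exact: dG.
  by apply/funext => s; rewrite /F big_ord1 fact0 divr1 expr0 mulr1.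
have dF := IHr (fun j jr => dG j (leqW jr)).
have dGr := dG r.+1 (leqnn _).
rewrite (_ : F r.+1 =
  F r + (G r.+1 * cst (r.+1`!%:R^-1)) * (cst y - id) ^+ r.+1); last first.
  apply/funext => s; rewrite /F big_ord_recr /= -[RHS]/(_ s + _ s).
  by rewrite -[X in _ = _ + X]/(_ s * _ s) exprfctE.
apply: is_derive_eq.
rewrite exprfctE /GRing.scale /=.
rewrite factS natrM -[(cst y - id) t]/(y - t).
rewrite -[(_ * cst _) t]/(G r.+1 t / (r.+1%:R * r`!%:R)).
have f0 : r`!%:R != 0 :> R by rewrite pnatr_eq0 -lt0n fact_gt0.
have r0 : r.+1%:R != 0 :> R by rewrite pnatr_eq0.
by field; rewrite f0 nat1r.
Qed.

Lemma within_continuous_taylor_sum (A : set R) r :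
  (forall j, (j <= r)%N -> {within A, continuous (G j)}) ->
  {within A, continuous (F r)}.
Proof.
move=> cG; rewrite (_ : F r =
  \sum_(j < r.+1) (G j * cst (j`!%:R^-1)) * (fun t => (y - t) ^+ j)); last first.
  by apply/funext => s; rewrite fct_sumE.
elim/big_ind : _ => [|f g cf cg|j _].
- by move=> t; exact: (@cst_continuous _ _ (0 : R)).
- by move=> t; apply: continuousD; [exact: cf|exact: cg].
move=> t; apply: continuousM.
  apply: continuousM; last exact: cst_continuous.
  by apply: cG; rewrite -ltnS.
move: t; apply: continuous_subspaceT => t.
apply: (@continuous_comp _ _ _ (fun s : R => y - s) (fun s => s ^+ j)).
  by apply: continuousB => //; exact: cst_continuous.
exact: exprn_continuous.
Qed.

End TaylorSum.

(** Cauchy form of the remainder: moving the expansion point from [x] to [y] turns the Taylor value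
    into [g y], so the remainder is an increment of [F]. *)
Lemma taylor_poly_cauchy (R : realType) (c d : R) (r : nat) (g : R -> R)
    (x y : R) :
  continuously_derivable c d r.+1 g -> x \in `[c, d] -> y \in `[c, d] ->
  exists t, [/\ t \in `[c, d], `|y - t| <= `|y - x| &
    g y - taylor_poly c d r g y x =
      derive_onn c d r.+1 g t / r`!%:R * (y - t) ^+ r * (y - x)].
Proof.
move=> [dg cg] xcd ycd.
pose F t := taylor_poly c d r g y t.
have Fy : F y = g y.
  rewrite /F /taylor_poly big_ord_recl /= fact0 divr1 expr0 mulr1.
  by rewrite big1 ?addr0// => j _; rewrite subrr expr0n /= mulr0.
(* Stated for arbitrary ordered endpoints, since [x] may lie on either side of [y]. *)
have mvt a b : a \in `[c, d] -> b \in `[c, d] -> a <= b ->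
  exists2 t, t \in `[a, b] & F b - F a =
    derive_onn c d r.+1 g t / r`!%:R * (y - t) ^+ r * (b - a).
  rewrite !in_itv /= => /andP[ca ad] /andP[cb bd] ab.
  apply: (@MVT_segment _ F
    (fun t => derive_onn c d r.+1 g t / r`!%:R * (y - t) ^+ r)) => //.
    move=> t; rewrite in_itv /= => /andP[at_ tb].
    apply: (@is_derive_taylor_sum _ (fun j => derive_onn c d j g)) => j jr.
    (* The mean value theorem differentiates only strictly between [a] and [b], so the one-sided
       derivatives at [c] and [d] never enter; at the ends continuity suffices. *)
    have tcd : t \in `]c, d[.
      by rewrite in_itv /= (le_lt_trans ca at_) (lt_le_trans tb bd).
    apply: (derive_on_is_derive tcd).
    by apply: dg => //; exact: subset_itv_oo_cc tcd.
  apply: (@within_continuous_taylor_sum _ (fun j => derive_onn c d j g)) => j jr.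
  apply: continuous_subspaceW (cg j (leqW jr)) => t /=.
  rewrite !in_itv /= => /andP[at_ tb].
  by rewrite (le_trans ca at_) (le_trans tb bd).
have inside a b t : a \in `[c, d] -> b \in `[c, d] -> t \in `[a, b] ->
    t \in `[c, d].
  rewrite !in_itv /= => /andP[ca _] /andP[_ bd] /andP[at_ tb].
  by rewrite (le_trans ca at_) (le_trans tb bd).
rewrite -Fy -/(F x); have [xy|/ltW yx] := leP x y.
  have [t tI E] := mvt _ _ xcd ycd xy.
  exists t; split; [exact: inside tI | | exact: E].
  move: tI; rewrite in_itv /= => /andP[xt ty].
  by rewrite !ger0_norm ?subr_ge0// lerB.
have [t tI E] := mvt _ _ ycd xcd yx.
exists t; split; [exact: inside tI | | by rewrite -opprB E -mulrN opprB].
move: tI; rewrite in_itv /= => /andP[yt tx].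
by rewrite !ler0_norm ?subr_le0// !opprB lerB.
Qed.

(** * Sign and support of [sigma] *)

Lemma sigma_ge0 (R : realType) (m : R) (eta : R -> R) (u : R) :
  0 < m -> activation_class m eta -> 0 <= sigma m eta u.
Proof.
by move=> m0 etaD; rewrite subr_ge0; apply: (activation_homo etaD); lra.
Qed.

Lemma sigma_eq0 (R : realType) (m : R) (eta : R -> R) (u : R) :
  0 < m -> activation_class m eta -> 2 * m <= `|u| -> sigma m eta u = 0.
Proof.
move=> m0 etaD; rewrite /sigma ler_normr => /orP[] um.
  by rewrite !(activation_right etaD) ?subrr //; lra.
by rewrite !(activation_left etaD) ?subrr //; lra.
Qed.

Lemma sigma_gt0 (R : realType) (m : R) (eta : R -> R) (u : R) :
  0 < m -> activation_class m eta -> `|u| < 2 * m -> 0 < sigma m eta u.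
Proof.
move=> m0 etaD; rewrite ltr_norml subr_gt0 => /andP[um1 um2].
(* For [u > 0] the first term is saturated at 1 and [u - m] lies in the transition zone; for [u < 0]
   the second term is 0 and [u + m] lies there; at [u = 0] both are saturated. *)
have [u0|u0|<-] := ltgtP 0 u.
- rewrite (activation_right etaD (y := u + m)); last lra.
  have /andP[_] // : 0 < eta (u - m) < 1.
  by apply: (activation_middle etaD); apply/andP; split; lra.
- rewrite (activation_left etaD (y := u - m)); last lra.
  have /andP[] // : 0 < eta (u + m) < 1.
  by apply: (activation_middle etaD); apply/andP; split; lra.
by rewrite sub0r add0r (activation_left etaD) ?(activation_right etaD).
Qed.

(** * Geometry of irregular grids *)

Section IrregularGrid.
Variables (R : realType) (c d : R) (n : nat) (z : nat -> R) (d1 d2 : R).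
Hypothesis zG : irregular_grid c d n z d1 d2.

Lemma grid_gap i j : (i <= j <= n)%N -> z i + (j - i)%:R * d1 <= z j.
Proof.
elim: j => [|j IHj] /andP[ij jn].
  by move: ij; rewrite leqn0 => /eqP ->; rewrite mul0r addr0.
move: ij; rewrite leq_eqVlt => /predU1P[->|ij].
  by rewrite subnn mul0r addr0.
have /andP[h _] := grid_mesh zG jn.
have := IHj; rewrite -ltnS ij ltnW // => /(_ isT).
by rewrite subSn // -natr1; lra.
Qed.

Lemma grid_in k : (k <= n)%N -> z k \in `[c, d].
Proof.
move=> kn; have d10 := grid_pos zG.
rewrite in_itv /= -(grid_first zG) -(grid_last zG).
have := @grid_gap 0 k; have := @grid_gap k n.
rewrite kn leqnn => /(_ isT) h2 /(_ isT) h1.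
apply/andP; split.
  by apply: le_trans h1; rewrite lerDl mulr_ge0 // ltW.
by apply: le_trans h2; rewrite lerDl mulr_ge0 // ltW.
Qed.

(** Adding up the [n] cells gives [n%:R * d1 <= d - c], while every cell has length at most
    [d2 < 2 * d1]. *)
Lemma mesh_max_le : (0 < n)%N -> mesh_max n z <= 2 * (d - c) / n%:R.
Proof.
move=> n0; have d10 := grid_pos zG.
have nR0 : 0 < n%:R :> R by rewrite ltr0n.
have := @grid_gap 0 n; rewrite leqnn /= subn0 (grid_first zG) (grid_last zG).
move=> /(_ isT) h.
have d1le : d1 <= (d - c) / n%:R by rewrite ler_pdivlMr //; lra.
have : 2 * d1 <= 2 * (d - c) / n%:R by rewrite -mulrA ler_pM2l.
apply: le_trans; apply: bigmax_le => [|k _]; first lra.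
have /andP[_ kd2] := grid_mesh zG (ltn_ord k).
by have := grid_quasi_uniform zG; lra.
Qed.

Lemma min_le_mesh_max : (0 < n)%N -> d1 <= mesh_max n z.
Proof.
move=> n0; have /andP[h _] := grid_mesh zG n0; apply: le_trans h _.
exact: (le_bigmax 0 (fun k : 'I_n => z k.+1 - z k) (Ordinal n0)).
Qed.

Lemma grid_near y : (0 < n)%N -> y \in `[c, d] ->
  exists k : 'I_n.+1, `|y - z k| < d1.
Proof.
move=> n0; rewrite in_itv /= -(grid_first zG) -(grid_last zG) => /andP[z0y yzn].
(* The cell containing [y] is found by induction on the number of cells: either [y] lies beyond
   [z p], in the last cell, or the last cell is dropped. *)
have [k kn /andP[zky yzk]] : exists2 k, (k < n)%N & z k <= y <= z k.+1.
  elim: n n0 yzn => [//|p IHp _ yzp].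
  have [yp|py] := leP y (z p); last by exists p => //; rewrite ltW.
  case: p IHp yp yzp => [_ yz0 yz1|p IHp yp _].
    by exists 0%N; rewrite ?z0y.
  by have [k kp ky] := IHp isT yp; exists k => //; exact: ltnW.
have /andP[h1 h2] := grid_mesh zG kn; have h3 := grid_quasi_uniform zG.
(* If the left node is too far, the right one is at distance at most [d2 - d1 < d1]. *)
have [h|h] := ltP (y - z k) d1.
  by exists (Ordinal (ltnW kn : (k < n.+1)%N)); rewrite ger0_norm //= subr_ge0.
by exists (Ordinal (kn : (k.+1 < n.+1)%N)); rewrite ler0_norm /=; lra.
Qed.

End IrregularGrid.

(** The error of a mean is the mean of the errors; terms of weight zero drop out, so [P i] is
    controlled only where [w i] is nonzero. *)
Lemma weighted_mean_dist (R : realFieldType) (I : finType) (w P : I -> R)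
    (v K : R) :
  (forall i, 0 <= w i) -> (exists i, 0 < w i) ->
  (forall i, w i != 0 -> `|P i - v| <= K) ->
  `|(\sum_i w i * P i) / (\sum_i w i) - v| <= K.
Proof.
move=> w0 [i0 wi0] wP.
have W0 : 0 < \sum_i w i.
  rewrite (bigD1 i0) //=; apply: ltr_wpDr => //; exact: sumr_ge0.
have -> : (\sum_i w i * P i) / (\sum_i w i) - v =
    (\sum_i w i * (P i - v)) / (\sum_i w i).
  under [X in _ = X / _]eq_bigr do rewrite mulrBr.
  by rewrite sumrB -mulr_suml mulrBl [_ * v]mulrC mulfK ?gt_eqF.
rewrite normrM normfV (gtr0_norm W0) ler_pdivrMr // mulr_sumr.
apply: le_trans (ler_norm_sum _ _ _) _; apply: ler_sum => i _.
have [->|wi] := eqVneq (w i) 0; first by rewrite mul0r mulr0 normr0.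
by rewrite normrM (ger0_norm (w0 i)) mulrC ler_wpM2r // wP.
Qed.

Lemma taylor_nn_operator_dist (R : realType) (c d m : R) (eta : R -> R)
    (n : nat) (z : nat -> R) (d1 d2 : R) (r : nat) (g : R -> R) (M y : R) :
  0 < m -> activation_class m eta -> (0 < n)%N ->
  irregular_grid c d n z d1 d2 -> continuously_derivable c d r.+1 g ->
  {in `[c, d], forall t, `|derive_onn c d r.+1 g t| <= M} ->
  y \in `[c, d] ->
  `|taylor_nn_operator c d m eta n z d1 r g y - g y| <= d1 ^+ r.+1 * M.
Proof.
move=> m0 etaD n0 zG gC gM ycd; have d10 := grid_pos zG.
(* Comparing the scaled argument with [2 * m] thus amounts to comparing the distance to the node
   with [d1]. *)
have scale x : `|2 * m / d1 * x| = 2 * m * (`|x| / d1).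
  by rewrite normrM gtr0_norm ?divr_gt0 ?mulr_gt0 // mulrAC mulrA.
have m20 : 0 < 2 * m by rewrite mulr_gt0.
apply: weighted_mean_dist => [k||k].
- exact: sigma_ge0.
- have [k yk] := grid_near zG n0 ycd; exists k; apply: sigma_gt0 => //.
  by rewrite scale gtr_pMr // ltr_pdivrMr // mul1r.
have [yk _|yk /eqP] := ltP `|y - z k| d1; last first.
  rewrite (sigma_eq0 m0 etaD) // scale ler_peMr ?(ltW m20) //.
  by rewrite ler_pdivlMr // mul1r.
have zk := grid_in zG (ltn_ord k : (k <= n)%N).
have [t [tcd yt E]] := taylor_poly_cauchy gC zk ycd.
(* The [r] factors [y - t] and the factor [y - z k] are each bounded by [d1]; the factorial is
   bounded below by 1. *)
rewrite distrC E -mulrA normrM mulrC; apply: ler_pM => //.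
  rewrite normrM normrX exprSr; apply: ler_pM => //.
    by rewrite lerXn2r ?nnegrE ?(ltW d10) // (le_trans yt) // ltW.
  exact: ltW.
apply: le_trans (gM _ tcd); rewrite normrM ler_piMr // normfV normr_nat.
by rewrite invf_le1 ?ler1n ?ltr0n fact_gt0.
Qed.

Unset Implicit Arguments.
Set Strict Implicit.
Set Printing Implicit Defensive.

Theorem corollary2p9 (R : realType) :
  (forall (c d : R) (z : nat -> nat -> R) (d1 d2 : nat -> R),
      c < d -> irregular_grids c d z d1 d2 ->
      exists C : R, 0 < C /\ refinement_condition C z)
  /\
  (forall (r : nat) (m : R) (eta : R -> R) (C : R),
      (1 <= r)%N -> 0 < m -> activation_class m eta -> 0 < C ->
      exists Ct : R, 0 < Ct /\
        forall (c d : R) (z : nat -> nat -> R) (d1 d2 : nat -> R),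
          c < d -> irregular_grids c d z d1 d2 -> refinement_condition C z ->
          forall g : R -> R, continuously_derivable c d r.+1 g ->
          forall n : nat, (0 < n)%N ->
            (sup_norm c d
               (fun y => (taylor_nn_operator c d m eta n (z n) (d1 n) r g y
                          - g y)%R)
             <= (Ct * n%:R ^- r.+1)%:E
                * sup_norm c d (derive_onn c d r.+1 g))%E).
Proof.
split=> [c d z d1 d2 cd zG|r m eta C r1 m0 etaD C0].
  exists (2 * (d - c)); split; first by rewrite mulr_gt0 ?subr_gt0.
  by move=> n n0; exact: mesh_max_le (zG n n0) n0.
(* The pointwise bound has factor [d1 ^+ r.+1], and [d1 n <= C / n%:R], so no constant other than
   this power arises. *)
exists (C ^+ r.+1); split; first exact: exprn_gt0.
move=> c d z d1 d2 cd zG zC g gC n n0.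
have nR0 : 0 < n%:R :> R by rewrite ltr0n.
have Ct0 : 0 < C ^+ r.+1 * n%:R ^- r.+1 by rewrite mulr_gt0 ?invr_gt0 ?exprn_gt0.
have supG t : t \in `[c, d] ->
    (`|derive_onn c d r.+1 g t|%:E <= sup_norm c d (derive_onn c d r.+1 g))%E.
  by move=> tcd; apply: ereal_sup_ubound; exists t.
have ccd : c \in `[c, d] by rewrite in_itv /= lexx ltW.
(* A finite norm is the real case; for [+oo] the right-hand side is [+oo] because its factor is
   positive; [-oo] is impossible since [c] lies in the interval. *)
case: (sup_norm c d (derive_onn c d r.+1 g)) supG => [M supG|_|/(_ c ccd)//].
  apply: ge_ereal_sup => _ [y ycd <-]; rewrite -EFinM lee_fin.
  have gM : {in `[c, d], forall t, `|derive_onn c d r.+1 g t| <= M}.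
    by move=> t /supG; rewrite lee_fin.
  apply: le_trans (taylor_nn_operator_dist m0 etaD n0 (zG n n0) gC gM ycd) _.
  apply: ler_wpM2r; first exact: le_trans (gM c ccd).
  rewrite -exprVn -exprMn lerXn2r ?nnegrE //.
  - exact/ltW/(grid_pos (zG n n0)).
  - by rewrite divr_ge0 ?ltW.
  exact: le_trans (min_le_mesh_max (zG n n0) n0) (zC n n0).
by rewrite gt0_muley ?leey // lte_fin.
Qed.
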